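(* There exists a $T_0$ space $X$ admitting no $k$-bounded sobrification; that is, there is a $T_0$ space $X$ for which there is no pair $(\overline{X},\xi)$ consisting of a $k$-bounded sober space $\overline{X}$ and a continuous mapping $\xi: X\to\overline{X}$ such that for every $k$-bounded sober space $S$ and every continuous mapping $f: X\to S$ there exists a unique continuous mapping $\bar f:\overline{X}\to S$ with $\bar f\circ\xi=f$.
   Context: For a $T_0$ space $X$ the specialization order is the partial order $x\le y$ iff $x\in \mathrm{cl}(\{y\})$; all suprema $\bigvee$ in $X$ are taken with respect to this order. A non-empty subset $F$ of a topological space $X$ is irreducible if whenever $F\subseteq A\cup B$ with $A,B$ closed in $X$, then $F\subseteq A$ or $F\subseteq B$. A $T_0$ space $X$ is $k$-bounded sober if for every irreducible closed subset $F$ of $X$ whose supremum $\bigvee F$ exists, there is a unique point $x\in X$ with $F=\mathrm{cl}(\{x\})$. A $k$-bounded sobrification of a $T_0$ space $X$ is a pair $(\overline X,\xi)$ consisting of a $k$-bounded sober space $\overline X$ and a continuous mapping $\xi:X\to\overline X$ such that for every continuous mapping $f$ from $X$ to a $k$-bounded sober space $S$ there is a unique continuous mapping $\bar f:\overline X\to S$ with $\bar f\circ\xi=f$. *)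

(* Defs.v *)
From mathcomp Require Import all_boot all_order all_algebra.
From mathcomp Require Import all_classical.
From mathcomp Require Import topology.

Set Implicit Arguments.
Unset Strict Implicit.
Unset Printing Implicit Defensive.

Local Open Scope classical_set_scope.

Definition specialization_le (T : topologicalType) (x y : T) : Prop :=
  closure [set y] x.

(* The library's [isLub] needs a [porderType] instance; the specialization
   order is only a relation on the carrier (a partial order when T is T0). *)
Definition specialization_sup (T : topologicalType) (A : set T) (s : T) : Prop :=
  (forall a, A a -> specialization_le a s) /\
  (forall b, (forall a, A a -> specialization_le a b) ->
     specialization_le s b).

Definition irreducible_set (T : topologicalType) (F : set T) : Prop :=
  F !=set0 /\
  forall A B : set T, closed A -> closed B ->
    F `<=` A `|` B -> F `<=` A \/ F `<=` B.

Definition k_bounded_sober (T : topologicalType) : Prop :=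
  kolmogorov_space T /\
  forall F : set T, irreducible_set F -> closed F ->
    (exists s, specialization_sup F s) ->
    exists! x : T, F = closure [set x].

Definition k_bounded_sobrification
    (X Xbar : topologicalType) (xi : X -> Xbar) : Prop :=
  [/\ k_bounded_sober Xbar,
      continuous xi &
      forall (S : topologicalType) (f : X -> S),
        k_bounded_sober S -> continuous f ->
        exists! fbar : Xbar -> S, continuous fbar /\ fbar \o xi = f].

(* Main.v *)
Require Import Defs.
From HB Require Import structures.
From mathcomp Require Import all_boot all_order all_algebra.
From mathcomp Require Import all_classical.
From mathcomp Require Import topology.

(** A reflective subcategory is closed under retracts, but k-bounded sobriety
    is not inherited by retracts: add a set [B] of pairwise incomparable upper
    bounds on top of the chain of natural numbers, with the Alexandroff
    topology. The chain itself is the only irreducible closed set that is not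
    the closure of a point, and it has a supremum iff [B] is a singleton. So
    the space is k-bounded sober for [B = bool] and not for its retract
    [B = unit]; the latter therefore has no k-bounded sobrification. *)

Set Implicit Arguments.
Unset Strict Implicit.
Unset Printing Implicit Defensive.

Local Open Scope classical_set_scope.

Lemma specialization_leP (T : topologicalType) (x y : T) :
  specialization_le x y <-> forall C : set T, closed C -> C y -> C x.
Proof.
split=> [xy C cC Cy|]; last first.
  by apply; [exact: closed_closure|exact: subset_closure].
by move: xy; rewrite /specialization_le closureE => /(_ C); apply; split=> // _ ->.
Qed.

Lemma continuous_specialization_le (S T : topologicalType) (f : S -> T) :
  continuous f -> {homo f : x y / specialization_le x y}.
Proof.
move=> cf x y /specialization_leP xy; apply/specialization_leP => C cC.
by apply: (xy (f @^-1` C)); apply: preimage_closed => // z _; exact: cf.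
Qed.

(** Continuous maps are monotone for specialization, so mutually inverse ones carry irreducible
    closed sets, suprema and point closures across. *)
Lemma k_bounded_sober_homeo (S T : topologicalType) (f : S -> T) (g : T -> S) :
  continuous f -> continuous g -> cancel f g -> cancel g f ->
  k_bounded_sober S -> k_bounded_sober T.
Proof.
move=> cf cg fK gK [S0 Ssober]; split=> [x y xy|F [[a Fa] Firr] cF [t [Ft tF]]].
  have /S0[A [|]] : g x != g y by apply: contra_neq xy => /(can_inj gK).
  - rewrite !inE => -[Ax Ay]; exists (g @^-1` A); left.
    by rewrite !inE; split=> //; exact: cg.
  - rewrite !inE => -[Ax Ay]; exists (g @^-1` A); right.
    by rewrite !inE; split=> //; exact: cg.
have closureT y : closure [set y] = g @^-1` closure [set g y].
  apply/seteqP; split=> z zy; first exact: (continuous_specialization_le cg).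
  by have := continuous_specialization_le cf zy; rewrite !gK.
have closureS x : closure [set x] = f @^-1` closure [set f x].
  apply/seteqP; split=> z zx; first exact: (continuous_specialization_le cf).
  by have := continuous_specialization_le cg zx; rewrite !fK.
have [|||x [Fx x_uniq]] := Ssober (f @^-1` F).
- split=> [|A B cA cB FAB]; first by exists (g a); rewrite /preimage/= gK.
  have [||z Fz|FA|FB] := Firr (g @^-1` A) (g @^-1` B).
  + by apply: preimage_closed => // z _; exact: cg.
  + by apply: preimage_closed => // z _; exact: cg.
  + by apply: FAB; rewrite /preimage/= gK.
  + by left=> z /FA; rewrite /preimage/= fK.
  + by right=> z /FB; rewrite /preimage/= fK.
- by apply: preimage_closed => // z _; exact: cf.
- exists (g t); split=> [z /Ft|b bF].
    by move=> /(continuous_specialization_le cg); rewrite fK.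
  rewrite -[b]fK; apply: continuous_specialization_le => //.
  apply: tF => z Fz; rewrite -[z]gK; apply: continuous_specialization_le => //.
  by apply: bF; rewrite /preimage/= gK.
exists (f x); split=> [|y Fy].
  rewrite closureT fK -Fx; apply/seteqP; split=> z; by rewrite /preimage/= gK.
rewrite -[y]gK; congr f; apply: x_uniq.
by rewrite closureS gK -Fy.
Qed.

(** Extending [i] along [xi] and composing with [r] gives a continuous left inverse of [xi];
    uniqueness of extensions makes it two-sided, so [X] is homeomorphic to the k-bounded sober
    [Xbar]. *)
Lemma k_bounded_sobrification_retract (X Y Xbar : topologicalType)
    (xi : X -> Xbar) (i : X -> Y) (r : Y -> X) :
  k_bounded_sobrification xi -> k_bounded_sober Y ->
  continuous i -> continuous r -> cancel i r -> k_bounded_sober X.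
Proof.
move=> [sXbar cxi univ] sY ci cr iK.
have [j [[cj jxi] _]] := univ Y i sY ci.
have cs : continuous (r \o j) by move=> z; apply: continuous_comp; [exact: cj|exact: cr].
have sxi : cancel xi (r \o j).
  by move=> x /=; rewrite -[j (xi x)]/((j \o xi) x) jxi iK.
(* Both [id] and [xi \o (r \o j)] extend [xi] along itself, hence they coincide. *)
have [h [_ h_uniq]] := univ Xbar xi sXbar cxi.
have hid : h = id by apply: h_uniq; split=> // z; exact: cvg_id.
have hxs : h = xi \o (r \o j).
  apply: h_uniq; split.
    by move=> z; apply: continuous_comp; [exact: cs|exact: cxi].
  by apply/funext => x; rewrite /= -[r _]/((r \o j) (xi x)) sxi.
apply: (k_bounded_sober_homeo cs cxi _ sxi sXbar) => z.
by rewrite -[RHS]/(id z) -hid hxs.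
Qed.

Definition topped_nat (B : Type) : Type := (nat + B)%type.

HB.instance Definition _ (B : choiceType) :=
  Choice.copy (topped_nat B) (nat + B)%type.

Definition topped_nat_le (B : Type) (x y : topped_nat B) : Prop :=
  match x, y with
  | inl m, inl n => m <= n
  | inl _, inr _ => True
  | inr _, inl _ => False
  | inr b, inr c => b = c
  end.

Section ToppedNat.
Variable B : choiceType.
Implicit Types (x y z : topped_nat B) (A F : set (topped_nat B)).

Lemma topped_nat_le_refl x : topped_nat_le x x.
Proof. by case: x => /=. Qed.

Lemma topped_nat_le_trans y x z :
  topped_nat_le x y -> topped_nat_le y z -> topped_nat_le x z.
Proof. by case: x y z => [m|b] [n|c] [p|d] //=; [exact: leq_trans|move=> ->]. Qed.

Lemma topped_nat_le_anti x y :
  topped_nat_le x y -> topped_nat_le y x -> x = y.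
Proof.
case: x y => [m|b] [n|c] //=; last by move=> ->.
by move=> mn nm; congr inl; apply/eqP; rewrite eqn_leq mn.
Qed.

Definition topped_nat_open A : Prop :=
  forall x y, topped_nat_le x y -> A x -> A y.

Lemma topped_nat_openT : topped_nat_open setT.
Proof. by []. Qed.

Lemma topped_nat_openI : setI_closed topped_nat_open.
Proof. by move=> A C oA oC x y xy [/(oA _ _ xy) ? /(oC _ _ xy)]. Qed.

Lemma topped_nat_open_bigU (I : Type) (f : I -> set (topped_nat B)) :
  (forall i, topped_nat_open (f i)) -> topped_nat_open (\bigcup_i f i).
Proof. by move=> of_ x y xy [i _ /(of_ _ _ _ xy)]; exists i. Qed.

HB.instance Definition _ := isOpenTopological.Build (topped_nat B)
  topped_nat_openT topped_nat_openI topped_nat_open_bigU.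

Lemma topped_nat_openP A :
  open A <-> forall x y, topped_nat_le x y -> A x -> A y.
Proof. by []. Qed.

Lemma topped_nat_closedP A :
  closed A <-> forall x y, topped_nat_le x y -> A y -> A x.
Proof.
rewrite -openC topped_nat_openP; split=> [oA x y xy Ay|clA x y xy nAx /(clA _ _ xy)//].
by apply: contrapT => /(oA _ _ xy).
Qed.

Lemma topped_nat_specialization x y :
  specialization_le x y <-> topped_nat_le x y.
Proof.
split=> [/specialization_leP|xy].
  move=> /(_ [set z | topped_nat_le z y]); apply; last exact: topped_nat_le_refl.
  by apply/topped_nat_closedP => u v; exact: topped_nat_le_trans.
by apply/specialization_leP => C /topped_nat_closedP lC; exact: lC.
Qed.

Lemma topped_nat_kolmogorov : kolmogorov_space (topped_nat B).
Proof.
move=> x y xy; pose up z : set (topped_nat B) := [set t | topped_nat_le z t].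
have nbhs_up z : nbhs z (up z).
  apply: open_nbhs_nbhs; split; last exact: topped_nat_le_refl.
  by apply/topped_nat_openP => u v uv zu; exact: topped_nat_le_trans uv.
have [xley|nxy] := pselect (topped_nat_le x y).
  exists (up y); right; rewrite !inE; split=> // yx.
  by move/eqP: xy; apply; exact: topped_nat_le_anti.
by exists (up x); left; rewrite !inE.
Qed.

End ToppedNat.

(** An irreducible closed set that has a supremum has a greatest element, and a lower set with a
    greatest element is the closure of that element alone. *)
Lemma k_bounded_sober_topped_bool : k_bounded_sober (topped_nat bool).
Proof.
split=> [|F [[a Fa] Firr] cF [s [Fs sF]]]; first exact: topped_nat_kolmogorov.
have lF := (topped_nat_closedP F).1 cF.
suff [x Fx xF] : exists2 x, F x & forall y, F y -> topped_nat_le y x.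
  have Fcl y : F y <-> closure [set x] y.
    split=> [/xF|]; first by move/topped_nat_specialization.
    by move/topped_nat_specialization => yx; exact: lF yx Fx.
  exists x; split=> [|y Fy]; first by apply/seteqP; split=> y /Fcl.
  apply: topped_nat_le_anti; last by apply: xF; rewrite Fy; exact: subset_closure.
  by apply/topped_nat_specialization; rewrite /specialization_le -Fy.
have [[b Fb]|nFr] := pselect (exists c, F (inr c)).
  exists (inr b) => // y Fy.
  (* Since [inr b] is maximal, its complement is closed. These two closed sets cover the space and
     [F] is not inside the second, so it lies below [inr b]. *)
  have [||z _|FA|FA] := Firr [set z | topped_nat_le z (inr b)] [set~ inr b].
  - by apply/topped_nat_closedP => u v; exact: topped_nat_le_trans.
  - apply/topped_nat_closedP => u v uv vb uE; apply: vb.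
    by move: uv; rewrite uE; case: v => //= c ->.
  - by have [->|zb] := pselect (z = inr b); [left; exact: topped_nat_le_refl|right].
  - exact: FA.
  - by case: (FA _ Fb).
(* Now [F] lies in the chain, so both tops bound it. *)
have Fub c y : F y -> specialization_le y (inr c).
  move=> Fy; apply/topped_nat_specialization; case: y Fy => // d Fd.
  by case: nFr; exists d.
have Fle y : F y -> topped_nat_le y s by move=> /Fs /topped_nat_specialization.
(* A top [inr b] is not a least bound, as the bound [inr (~~ b)] is not above it. A supremum
   [inl n.+1] lies in [F], or else [inl n] would be a smaller bound. If it is [inl 0], then
   nonemptiness forces [inl 0] into [F]. *)
case: s sF {Fs} Fle => [[|n]|b] sF Fle; last first.
- have /topped_nat_specialization /= := sF _ (Fub (~~ b)).
  by case: b {sF Fle}.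
- have [Fn|nFn] := pselect (F (inl n.+1)); first by exists (inl n.+1).
  have /topped_nat_specialization /= : specialization_le (inl n.+1 : topped_nat bool) (inl n).
    apply: sF => -[m|c] Fm; apply/topped_nat_specialization; last exact: Fle Fm.
    have /= := Fle _ Fm; rewrite leq_eqVlt => /orP[/eqP mE|//].
    by rewrite mE in Fm.
  by rewrite ltnn.
- by exists (inl 0) => //; case: a Fa => [[|m]|c] Fa //; have := Fle _ Fa.
Qed.

(** With a single top, the chain has that top as supremum, yet it has no greatest element and so is
    no point closure. *)
Lemma not_k_bounded_sober_topped_unit : ~ k_bounded_sober (topped_nat unit).
Proof.
move=> [_ sober]; pose F : set (topped_nat unit) := range inl.
have cF : closed F.
  by apply/topped_nat_closedP => x y /[swap] -[n _ <-]; case: x => // m _; exists m.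
have Firr : irreducible_set F.
  split=> [|A C /topped_nat_closedP lA /topped_nat_closedP lC FAC]; first by exists (inl 0); exists 0.
  (* If [A] misses [m] and [C] misses [n], then [maxn m n] is in neither lower set. *)
  apply: contrapT => /not_orP[/existsNP[x /not_implyP[[m _ <-] nAm]]].
  move=> /existsNP[y /not_implyP[[n _ <-] nCn]].
  have [|Amn|Cmn] := FAC (inl (maxn m n)); first by exists (maxn m n).
  - by apply: nAm; apply: lA Amn; exact: leq_maxl.
  - by apply: nCn; apply: lC Cmn; exact: leq_maxr.
have [|x [Fx _]] := sober F Firr cF.
  exists (inr tt); split=> [_ [n _ <-]|b Fb]; first exact/topped_nat_specialization.
  apply/topped_nat_specialization; case: b Fb => [n|[]]// Fb.
  have /topped_nat_specialization/= : specialization_le (inl n.+1 : topped_nat unit) (inl n).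
    by apply: Fb; exists n.+1.
  by rewrite ltnn.
have : F x by rewrite Fx; exact: subset_closure.
case=> n _ xE; have : F (inl n.+1) by exists n.+1.
by rewrite Fx -xE => /topped_nat_specialization/=; rewrite ltnn.
Qed.

Definition topped_nat_map (B C : Type) (h : B -> C) (x : topped_nat B) :
    topped_nat C :=
  match x with inl n => inl n | inr b => inr (h b) end.

Lemma topped_nat_map_continuous (B C : choiceType) (h : B -> C) :
  continuous (topped_nat_map h).
Proof.
apply/continuousP => A /topped_nat_openP oA; apply/topped_nat_openP => x y xy.
apply: oA.
by case: x y xy => [m|b] [n|c] //= ->.
Qed.

Theorem theorem3p3 :
  exists X : topologicalType,
    kolmogorov_space X /\
    ~ (exists (Xbar : topologicalType) (xi : X -> Xbar),
         k_bounded_sobrification xi).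
Proof.
exists (topped_nat unit); split; first exact: topped_nat_kolmogorov.
move=> [Xbar [xi xiP]]; apply: not_k_bounded_sober_topped_unit.
(* The section sends the single top to [true]; the retraction merges the two tops. *)
apply: (k_bounded_sobrification_retract xiP k_bounded_sober_topped_bool
  (@topped_nat_map_continuous _ _ (fun=> true))
  (@topped_nat_map_continuous _ _ (fun=> tt))).
by case=> [n|[]].
Qed.
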